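(* Let $P$ be the ReLU activation set realized by a fixed input $x_0$ and weight $w_0$, and let $u$ be the (nonzero) virtual polynomial of type $(i,L)$ induced by $P$. Then $u$ has an irreducible factorization $u=g_1\cdots g_n$ into $n$ irreducible non-constant real polynomials if and only if the $P$-active neural network has exactly $n-1$ layers containing a unique (active) node. Moreover, if $\ell_1<\dots<\ell_{n-1}$ are these layers, set $\ell_0=1$ and $\ell_n=L$. Then, up to constant factors, each factor $g_s$ is the output of the sub-network of the $P$-active network that starts at layer $\ell_{s-1}$ and ends at layer $\ell_s$. For $s=1$ this is the output of the unique node of layer $\ell_1$ computed from the input $x_0$. For $s\ge2$ it is the linear-network output at layer $\ell_s$ (at the unique node, respectively at output node $i$ when $s=n$) obtained by feeding the value $1$ into the unique node of layer $\ell_{s-1}$.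
   Context: Network: a fully connected feedforward network with $L$ layers of widths $d_1,\dots,d_L$ and no biases. The weights are the entries $w^{(k)}_{(i,j)}$ of $W_k\in\mathbb{R}^{d_{k+1}\times d_k}$, $k=1,\dots,L-1$; $w^{(k)}_{(i,j)}$ is the weight on the edge from node $i$ of layer $k$ to node $j$ of layer $k+1$. All weights together form $w\in\mathbb{R}^N$. Forward pass: $x^{(1)}=x$; $z^{(k+1)}=W_kx^{(k)}$; for hidden layers $2\le k\le L-1$, $x^{(k)}_i=\max(0,z^{(k)}_i)$; and $F_w(x)=z^{(L)}$. A hidden node is active for $(x,w)$ if its output is positive. ReLU activation set: an assignment of ''active''/''inactive'' to every hidden node. The activation set realized by $(x_0,w_0)$ records which hidden nodes are active. Such a set induces a linear network in which inactive nodes output $0$ and active nodes output their pre-output $z^{(k)}_j$. Virtual polynomial of type $(i,k)$ for fixed input $x$: the output of node $(i,k)$ in the induced linear network, as a polynomial in the weight variables. $P$-active neural network: the sub-network consisting of the input nodes, the $P$-active hidden nodes, the output node $i$ under consideration, and all edges between these nodes. Irreducible: a real polynomial is irreducible if it is non-constant and is not a product of two non-constant polynomials. Real polynomials factor uniquely into irreducibles up to constants. *)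

(* Defs.v *)
From HB Require Import structures.
From mathcomp Require Import all_boot all_order all_algebra.
Set Implicit Arguments. Unset Strict Implicit. Unset Printing Implicit Defensive.
Import Order.TTheory GRing.Theory Num.Theory.
Local Open Scope ring_scope.

Fixpoint mpoly (R : idomainType) (n : nat) : idomainType :=
  match n with
  | 0 => R
  | n'.+1 => ({poly mpoly R n'} : idomainType)
  end.

Fixpoint mpconst (R : idomainType) (n : nat) (c : R) : mpoly R n :=
  match n return mpoly R n with
  | 0 => c
  | n'.+1 => (mpconst n' c)%:P
  end.

(* the variable X_v (v < n); 0 if v >= n *)
Fixpoint mpvar (R : idomainType) (n v : nat) : mpoly R n :=
  match n return mpoly R n with
  | 0 => 0
  | n'.+1 => if v == n' then 'X else (mpvar R n' v)%:P
  end.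

Definition mp_is_const (R : idomainType) (n : nat) (p : mpoly R n) : Prop :=
  exists c : R, p = mpconst n c.

Definition mp_irreducible (R : idomainType) (n : nat) (p : mpoly R n) : Prop :=
  ~ mp_is_const p /\
  forall q r : mpoly R n, p = q * r -> mp_is_const q \/ mp_is_const r.

(* Networks.  Layers are numbered 1..L, layer k has width d k; nodes  *)
(* of layer k are 0..d k - 1.  Weights are given as w k i j = w^{(k)}_{(i,j)}, *)
(* the weight on the edge from node i of layer k to node j of layer k+1 *)
(* (1 <= k <= L-1).  Inputs are x : nat -> T (entries 0..d 1 - 1).    *)

Definition relu (R : realDomainType) (a : R) : R := Num.max 0 a.

(* outputs x^{(k)} of the nodes of layer k in the ReLU network (k <= L-1);
   layer 1 is the input *)
Fixpoint relu_out (R : realDomainType) (d : nat -> nat)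
  (w : nat -> nat -> nat -> R) (x : nat -> R) (k : nat) : nat -> R :=
  match k with
  | 0 => x
  | k'.+1 =>
      if k' is 0 then x else
      fun j => relu (\sum_(i < d k') w k' i j * relu_out d w x k' i)
  end.

Definition activation_set (R : realDomainType) (d : nat -> nat)
  (w : nat -> nat -> nat -> R) (x : nat -> R) : nat -> nat -> bool :=
  fun k j => 0 < relu_out d w x k j.

(* The linear network induced by an activation set P, over an arbitrary
   commutative ring T, started at layer a with values xa on the nodes of
   layer a: values of the nodes of layer k (a < k <= L); inactive hidden
   nodes output 0, active hidden nodes output their pre-output, the
   output layer L outputs its pre-output. *)
Fixpoint lin_net (T : comNzRingType) (L : nat) (d : nat -> nat)
  (P : nat -> nat -> bool) (w : nat -> nat -> nat -> T)
  (a : nat) (xa : nat -> T) (k : nat) : nat -> T :=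
  match k with
  | 0 => xa
  | k'.+1 =>
      if (k'.+1 <= a)%N then xa else
      fun j =>
        let z := \sum_(i < d k') w k' i j * lin_net L d P w a xa k' i in
        if (k'.+1 < L)%N then (if P k'.+1 j then z else 0) else z
  end.

(* Enumeration of the weight variables: N = total number of weights,
   w^{(k)}_{(i,j)} is variable number widx k i j. *)
Definition nweights (L : nat) (d : nat -> nat) : nat :=
  (\sum_(1 <= m < L) d m * d m.+1)%N.

Definition widx (d : nat -> nat) (k i j : nat) : nat :=
  ((\sum_(1 <= m < k) d m * d m.+1) + i * d k.+1 + j)%N.

Definition wvars (R : idomainType) (L : nat) (d : nat -> nat) :
  nat -> nat -> nat -> mpoly R (nweights L d) :=
  fun k i j => mpvar R (nweights L d) (widx d k i j).

Definition virtual_poly (R : idomainType) (L : nat) (d : nat -> nat)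
  (P : nat -> nat -> bool) (x0 : nat -> R) (k j : nat) : mpoly R (nweights L d) :=
  lin_net L d P (wvars R L d) 1 (fun t => mpconst (nweights L d) (x0 t)) k j.

Definition unique_node_layer (d : nat -> nat) (P : nat -> nat -> bool) (l : nat) : bool :=
  #|[set j : 'I_(d l) | P l j]| == 1%N.

Definition unique_layers (L : nat) (d : nat -> nat) (P : nat -> nat -> bool) : seq nat :=
  [seq l <- iota 2 (L - 2) | unique_node_layer d P l].

Definition the_node (d : nat -> nat) (P : nat -> nat -> bool) (l : nat) : nat :=
  find (P l) (iota 0 (d l)).

Definition bounds (L : nat) (d : nat -> nat) (P : nat -> nat -> bool) : seq nat :=
  1%N :: rcons (unique_layers L d P) L.

(* The s-th factor (s = 0..n-1, i.e. the paper's g_{s+1}): the output of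
   the sub-network of the P-active network from layer l_s to l_{s+1},
   at the unique node of l_{s+1} (at the output node i if l_{s+1} = L).
   For s = 0 it is computed from the input x0; for s >= 1 from the value
   1 fed into the unique node of layer l_s. *)
Definition subnet_factor (R : idomainType) (L : nat) (d : nat -> nat)
  (P : nat -> nat -> bool) (x0 : nat -> R) (i s : nat) : mpoly R (nweights L d) :=
  let n := (size (unique_layers L d P)).+1 in
  let a := nth 0%N (bounds L d P) s in
  let b := nth 0%N (bounds L d P) s.+1 in
  let jb := if s.+1 == n then i else the_node d P b in
  let xa : nat -> mpoly R (nweights L d) :=
    if s == 0%N then (fun t => mpconst (nweights L d) (x0 t))
    else (fun t => ((t == the_node d P a)%:R)) in
  lin_net L d P (wvars R L d) a xa b jb.

(* Main.v *)
Require Import Defs.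
From HB Require Import structures.
From mathcomp Require Import all_boot all_order all_algebra.
From mathcomp Require Import zify.
Set Implicit Arguments. Unset Strict Implicit. Unset Printing Implicit Defensive.
Import Order.TTheory GRing.Theory Num.Theory.
Local Open Scope ring_scope.

(* Every path meets each unique-node layer in its unique node, so the virtual
   polynomial is exactly the product of the sub-network outputs.  To see that
   such an output f is irreducible, scale by T the weights crossing a cut that
   every path crosses exactly once: f becomes T f, which has degree 1 in T, so
   if f = q h then q or h contains no weight of the cut.  Cuts consisting of a
   whole layer of weights show that each layer belongs to one factor.  If j, j'
   are two active nodes of an inner layer, the cut "into j, or out of a node
   other than j" shows that the layers of weights before and after it belong to
   the same factor, because f does involve weights into j and out of j'.
   The same argument applies to f r = q h when r is free of the weights of f,
   say with q free of them; specialising these weights at a point where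
   f does not vanish then shows that f divides h.  Hence the factors can be
   cancelled one at a time from any irreducible factorization of the virtual
   polynomial, which determines the number of its factors. *)

(** * Substitutions and partial degrees in iterated polynomial rings *)

Section MPoly.
Variable R : idomainType.

Fact mpconst_zmod_morphism n : zmod_morphism (@mpconst R n).
Proof. by elim: n => [|n IHn] x y //=; rewrite IHn rmorphB. Qed.

Fact mpconst_monoid_morphism n : monoid_morphism (@mpconst R n).
Proof.
elim: n => [|n [IH1 IHM]] //=.
by split=> [|x y]; rewrite ?IH1 ?rmorph1 // IHM rmorphM.
Qed.

HB.instance Definition _ n :=
  GRing.isZmodMorphism.Build R (mpoly R n) (@mpconst R n)
    (@mpconst_zmod_morphism n).
HB.instance Definition _ n :=
  GRing.isMonoidMorphism.Build R (mpoly R n) (@mpconst R n)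
    (@mpconst_monoid_morphism n).

Fixpoint mpeval (T : comNzRingType) (f : {rmorphism R -> T}) (env : nat -> T)
  (n : nat) : {rmorphism mpoly R n -> T} :=
  match n return {rmorphism mpoly R n -> T} with
  | 0 => f
  | n'.+1 => horner_morph (fun x => mulrC (env n') (mpeval f env n' x))
  end.

Lemma mpeval_const (T : comNzRingType) (f : {rmorphism R -> T}) env n c :
  mpeval f env n (mpconst n c) = f c.
Proof. by elim: n => //= n IHn; rewrite horner_morphC. Qed.

Lemma mpeval_var (T : comNzRingType) (f : {rmorphism R -> T}) env n v :
  (v < n)%N -> mpeval f env n (mpvar R n v) = env v.
Proof.
elim: n => //= n IHn; rewrite ltnS leq_eqVlt.
case: eqP => [-> _ | _ /= /IHn <-]; first by rewrite horner_morphX.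
by rewrite horner_morphC.
Qed.

Lemma mpoly_rmorph_ext (T : comNzRingType) n (f g : {rmorphism mpoly R n -> T}) :
  (forall c, f (mpconst n c) = g (mpconst n c)) ->
  (forall v, (v < n)%N -> f (mpvar R n v) = g (mpvar R n v)) -> f =1 g.
Proof.
elim: n f g => [|n IHn] f g fgC fgX; first exact: fgC.
have fgP (p : mpoly R n) : f p%:P = g p%:P.
  apply: (IHn (f \o polyC) (g \o polyC)) => [c|v lt_vn] /=; first exact: fgC.
  by have:= fgX v (ltnW lt_vn); rewrite /= ltn_eqF.
have /= := fgX n (ltnSn n); rewrite eqxx => fgXn.
elim/poly_ind => [|p c IHp]; first by rewrite !rmorph0.
by rewrite !rmorphD !rmorphM fgP IHp fgXn.
Qed.

Section Free.
Variable n : nat.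
Local Notation M := (mpoly R n).
Local Notation C := (@mpconst R n).
Local Notation X := (mpvar R n).

Definition mpkill (S : pred nat) : {rmorphism M -> M} :=
  mpeval C (fun v => if S v then 0 else X v) n.

(* The degree in ['X] of [mpscale S p] is the total degree of [p] in the
   variables of [S]. *)
Definition mpscale (S : pred nat) : {rmorphism M -> {poly M}} :=
  mpeval (polyC \o C) (fun v => if S v then 'X * (X v)%:P else (X v)%:P) n.

(** Setting the variables of [S] to 0 removes just the monomials that involve them, so [p] is
    unchanged iff it has none. *)
Definition free_of (S : pred nat) (p : M) := mpkill S p == p.

Lemma mpkillC S c : mpkill S (C c) = C c.
Proof. exact: mpeval_const. Qed.

Lemma mpkillX S v : (v < n)%N -> mpkill S (X v) = if S v then 0 else X v.
Proof. exact: mpeval_var. Qed.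

Lemma mpscaleC S c : mpscale S (C c) = (C c)%:P.
Proof. exact: mpeval_const. Qed.

Lemma mpscaleX S v : (v < n)%N ->
  mpscale S (X v) = if S v then 'X * (X v)%:P else (X v)%:P.
Proof. exact: mpeval_var. Qed.

Lemma mpscale_horner1 S p : (mpscale S p).[1] = p.
Proof.
apply: (mpoly_rmorph_ext (f := horner_eval 1 \o mpscale S) (g := idfun))
  => [c|v lt_vn] /=; rewrite /horner_eval ?mpscaleC ?mpscaleX ?hornerC //.
by case: ifP; rewrite !hornerE.
Qed.

Lemma mpscale_horner0 S p : (mpscale S p).[0] = mpkill S p.
Proof.
apply: (mpoly_rmorph_ext (f := horner_eval 0 \o mpscale S) (g := mpkill S))
  => [c|v lt_vn] /=; rewrite /horner_eval ?mpscaleC ?mpscaleX ?mpkillC ?mpkillX //.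
  by rewrite hornerC.
by case: ifP; rewrite !hornerE.
Qed.

Lemma mpscale_eq0 S p : (mpscale S p == 0) = (p == 0).
Proof.
apply/eqP/eqP => [|->]; last by rewrite rmorph0.
by rewrite -{2}(mpscale_horner1 S p) => ->; rewrite horner0.
Qed.

Lemma free_ofC S c : free_of S (C c).
Proof. by rewrite /free_of mpkillC. Qed.

Lemma mpscale_free S p : free_of S p -> mpscale S p = p%:P.
Proof.
move/eqP <-; apply: (mpoly_rmorph_ext (f := mpscale S \o mpkill S)
  (g := polyC \o mpkill S)) => [c|v lt_vn] /=.
  by rewrite mpkillC mpscaleC.
by rewrite mpkillX //; case: ifP => Sv; rewrite ?rmorph0 ?mpscaleX ?Sv.
Qed.

(** The values of [mpscale S p] at 1 and 0 are [p] and [mpkill S p]; for a constant polynomial they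
    agree. *)
Lemma free_of_size S p : (size (mpscale S p) <= 1)%N = free_of S p.
Proof.
apply/idP/idP => [/size1_polyC sp1|/mpscale_free ->]; last exact: size_polyC_leq1.
apply/eqP; rewrite -mpscale_horner0 -[RHS](mpscale_horner1 S).
by rewrite sp1 !hornerC.
Qed.

Lemma mpkill_kill S S' p : mpkill S (mpkill S' p) = mpkill (predU S S') p.
Proof.
apply: (mpoly_rmorph_ext (f := mpkill S \o mpkill S')) => [c|v lt_vn] /=.
  by rewrite !mpkillC.
rewrite !mpkillX //=.
by case: (S' v); rewrite ?orbT ?rmorph0 // orbF mpkillX.
Qed.

Lemma eq_mpkill S S' : S =1 S' -> mpkill S =1 mpkill S'.
Proof.
move=> eqS; apply: mpoly_rmorph_ext => [c|v lt_vn]; rewrite ?mpkillC //.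
by rewrite !mpkillX // eqS.
Qed.

Lemma free_ofS S S' p : subpred S' S -> free_of S p -> free_of S' p.
Proof.
move=> sS'S /eqP fSp; apply/eqP; rewrite -fSp mpkill_kill.
by apply: eq_mpkill => v /=; case S'v: (S' v); rewrite ?(sS'S _ S'v).
Qed.

Lemma free_ofU S S' p : free_of S p -> free_of S' p -> free_of (predU S S') p.
Proof. by move=> /eqP fSp /eqP fS'p; rewrite /free_of -mpkill_kill fS'p fSp. Qed.

Lemma free_ofM S p q : free_of S p -> free_of S q -> free_of S (p * q).
Proof. by move=> /eqP fp /eqP fq; rewrite /free_of rmorphM fp fq. Qed.

Lemma free_of_prod S (I : Type) (r : seq I) (P : pred I) (F : I -> M) :
  (forall i, P i -> free_of S (F i)) -> free_of S (\prod_(i <- r | P i) F i).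
Proof.
move=> fF; elim/big_rec: _ => [|i p Pi fp]; last by rewrite free_ofM ?fF.
by rewrite /free_of rmorph1.
Qed.

Lemma free_of_mull S p q : p * q != 0 -> free_of S (p * q) -> free_of S p.
Proof.
rewrite mulf_eq0 -!free_of_size -(mpscale_eq0 S p) -(mpscale_eq0 S q) negb_or.
case/andP=> p0 q0; rewrite rmorphM size_mul //.
by move: p0 q0; rewrite -!size_poly_gt0; lia.
Qed.

(** Degrees in ['X] add up and their sum is 1, so one factor has degree 0. *)
Lemma free_of_linear S p q : p * q != 0 -> mpscale S (p * q) = 'X * (p * q)%:P ->
  free_of S p || free_of S q.
Proof.
move=> pq0 E; have := congr1 (fun f : {poly M} => size f) E.
rewrite ['X * _]mulrC size_mulX ?polyC_eq0 // rmorphM.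
move: pq0; rewrite size_polyC => pq0.
move: (pq0); rewrite mulf_eq0 -(mpscale_eq0 S p) -(mpscale_eq0 S q) negb_or.
case/andP=> p0 q0; rewrite size_mul // p0 q0 /= -!free_of_size.
move: p0 q0; rewrite -!size_poly_gt0.
move: (size (mpscale S p)) (size (mpscale S q)) => a b; lia.
Qed.

Lemma free_of_linear_eq0 S p : mpscale S p = 'X * p%:P -> free_of S p -> p = 0.
Proof.
by move=> E /eqP <-; rewrite -mpscale_horner0 E !hornerE.
Qed.

Lemma mp_is_constP p : mp_is_const p <-> free_of predT p.
Proof.
split=> [[c ->]|/eqP <-]; first exact: free_ofC.
exists (mpeval (T := R) idfun (fun=> 0) n p).
apply: (mpoly_rmorph_ext (f := mpkill predT)
  (g := C \o mpeval (T := R) idfun (fun=> 0) n)) => [c|v lt_vn] /=.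
  by rewrite mpkillC mpeval_const.
by rewrite mpkillX // mpeval_var // rmorph0.
Qed.

Lemma mpconst_eq0 c : (C c == 0) = (c == 0).
Proof.
apply/eqP/eqP => [/(congr1 (mpeval idfun (fun=> 0) n))|->]; last exact: rmorph0.
by rewrite mpeval_const rmorph0.
Qed.

End Free.
End MPoly.

Arguments mpkill {R n}.
Arguments mpscale {R n}.

(** * Recovering an edge from the number of its weight variable *)

Fixpoint edge_from (d : nat -> nat) (fuel k v : nat) : nat * nat * nat :=
  if fuel is fuel'.+1 then
    if (v < d k * d k.+1)%N then (k, v %/ d k.+1, v %% d k.+1)%N
    else edge_from d fuel' k.+1 (v - d k * d k.+1)
  else (0, 0, 0)%N.

(** Layer blocks are subtracted until the index falls into the block of layer [k], where division by
    [d k.+1] separates [i] from [j]; [fuel] bounds the number of blocks tried. *)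
Lemma edge_fromK d fuel m k i j :
  (m <= k)%N -> (k - m < fuel)%N -> (i < d k)%N -> (j < d k.+1)%N ->
  edge_from d fuel m (\sum_(m <= l < k) d l * d l.+1 + i * d k.+1 + j) = (k, i, j).
Proof.
move=> + + lt_i lt_j; elim: fuel m => // fuel IHf m le_mk lt_f /=.
have lt_ij : (i * d k.+1 + j < d k * d k.+1)%N.
  by apply: (@leq_trans (i.+1 * d k.+1)); rewrite ?leq_mul2r ?lt_i ?orbT // mulSn; lia.
have [lt_mk|ge_mk] := ltnP m k; last first.
  have -> : m = k by lia.
  rewrite big_geq // add0n lt_ij divnMDl ?divn_small ?addn0 ?modnMDl ?modn_small //.
  by lia.
rewrite big_ltn // -!addnA ltnNge leq_addr /= addKn addnA IHf //; lia.
Qed.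

Definition edge (L : nat) (d : nat -> nat) := edge_from d L 1.

Definition valid_edge (L : nat) (d : nat -> nat) k i j :=
  [&& 1 <= k, k < L, i < d k & j < d k.+1]%N.

Lemma widxK L d k i j : valid_edge L d k i j -> edge L d (widx d k i j) = (k, i, j).
Proof. by case/and4P=> *; rewrite /edge edge_fromK //; lia. Qed.

Lemma widx_ltn L d k i j : valid_edge L d k i j -> (widx d k i j < nweights L d)%N.
Proof.
case/and4P=> k1 ltkL lt_i lt_j; rewrite /nweights (big_cat_nat (n := k)) //=; last exact: ltnW.
rewrite (big_ltn ltkL) /widx -addnA ltn_add2l ltn_addr //.
by apply: (@leq_trans (i.+1 * d k.+1)); rewrite ?leq_mul2r ?lt_i ?orbT // mulSn; lia.
Qed.

(** * Linear networks and their unique active nodes *)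

Lemma the_nodeP d P l : unique_node_layer d P l ->
  [/\ (the_node d P l < d l)%N, P l (the_node d P l)
    & forall j, (j < d l)%N -> P l j -> j = the_node d P l].
Proof.
case/cards1P=> i0 /setP Hi0.
have H j (lt_j : (j < d l)%N) : P l j = (Ordinal lt_j == i0).
  by have := Hi0 (Ordinal lt_j); rewrite !inE.
have hasP : has (P l) (iota 0 (d l)).
  apply/hasP; exists (val i0); first by rewrite mem_iota /=.
  by case: i0 H Hi0 => m lt_m H _ /=; rewrite H.
have lt_n : (the_node d P l < d l)%N.
  by rewrite /the_node -{2}(size_iota 0 (d l)) -has_find.
have Pn : P l (the_node d P l).
  by have := nth_find 0%N hasP; rewrite nth_iota.
split=> // j lt_j; rewrite H => /eqP Ej; move: Pn; rewrite H => /eqP.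
by rewrite -Ej => /(congr1 val).
Qed.

Section LinNet.
Variables (L : nat) (d : nat -> nat) (P : nat -> nat -> bool).

Section Ring.
Variable T : comNzRingType.
Implicit Types (w : nat -> nat -> nat -> T) (x : nat -> T).

Lemma lin_net_start w a x : lin_net L d P w a x a = x.
Proof. by case: a => //= a; rewrite leqnn. Qed.

Lemma lin_netS w a x k j : (a <= k)%N ->
  lin_net L d P w a x k.+1 j =
  if (k.+1 < L)%N && ~~ P k.+1 j then 0
  else \sum_(i < d k) w k i j * lin_net L d P w a x k i.
Proof.
by move=> le_ak; rewrite /= ltnNge le_ak /=; case: (k.+1 < L)%N; case: (P k.+1 j).
Qed.

Lemma lin_net_inactive w a x k j : (a < k < L)%N -> ~~ P k j ->
  lin_net L d P w a x k j = 0.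
Proof.
case: k => // k /andP[lt_ak ltkL] Pj.
by rewrite lin_netS // ltkL Pj.
Qed.

Lemma eq_lin_net w w' a x x' b j : (1 <= a <= b)%N -> (b <= L)%N -> (j < d b)%N ->
  (forall k i t, (a <= k < b)%N -> valid_edge L d k i t -> w k i t = w' k i t) ->
  (forall i, (i < d a)%N -> x i = x' i) ->
  lin_net L d P w a x b j = lin_net L d P w' a x' b j.
Proof.
case/andP=> a1; elim: b j => [|b IHb] j le_ab le_bL lt_j eqw eqx; first by lia.
have [lt_ba|le_ab'] := ltnP b a.
  have ea : b.+1 = a by lia.
  by rewrite -ea !lin_net_start eqx // -ea.
rewrite !lin_netS //; case: ifP => // _; apply: eq_bigr => i _.
have ve : valid_edge L d b i j by rewrite /valid_edge ltn_ord lt_j; lia.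
rewrite eqw //; last by lia.
congr (_ * _); apply: IHb => //; first by lia.
by move=> k i' t Hk; apply: eqw; lia.
Qed.

Lemma lin_net_zero w a x k b j : (a <= k <= b)%N -> (b <= L)%N -> (j < d b)%N ->
  (forall i, (i < d k)%N -> lin_net L d P w a x k i = 0) ->
  lin_net L d P w a x b j = 0.
Proof.
move=> + + + x0; case/andP=> le_ak; elim: b j => [|b IHb] j le_kb le_bL lt_j.
  by move: (x0 j); have -> : k = 0%N by [lia]; apply.
have [lt_bk|le_kb'] := ltnP b k.
  have ek : b.+1 = k by lia.
  by rewrite ek x0 // -ek.
rewrite lin_netS; last by lia.
case: ifP => // _; apply: big1 => i _; rewrite IHb ?mulr0 //; lia.
Qed.

(* [phi] is the side of a cut that the paths can only cross in one
   direction; the weights that cross it are multiplied by [c]. *)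
Lemma lin_net_cut (phi : nat -> nat -> bool) (c : T) w a x b j :
  (a <= b)%N -> (forall i, phi a i = false) ->
  (forall k i t, phi k i -> phi k.+1 t) ->
  lin_net L d P
    (fun k i t => if phi k.+1 t && ~~ phi k i then c * w k i t else w k i t) a x b j
  = (if phi b j then c else 1) * lin_net L d P w a x b j.
Proof.
move=> + phia phiS; elim: b j => [|b IHb] j le_ab.
  have -> : a = 0%N by lia.
  by rewrite !lin_net_start; move: phia; have -> : a = 0%N by [lia]; move=> ->; rewrite mul1r.
have [lt_ba|le_ab'] := ltnP b a.
  have -> : b.+1 = a by lia.
  by rewrite !lin_net_start phia mul1r.
rewrite !lin_netS //; case: ifP => _; first by rewrite mulr0.
rewrite mulr_sumr; apply: eq_bigr => i _; rewrite IHb //.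
have := @phiS b i j.
case: (phi b i) (phi b.+1 j) => [] [] //= H; rewrite ?mul1r ?mulrA //.
- by rewrite (mulrC c).
- by have := H isT.
Qed.

(* All paths go through the unique active node of layer [l]. *)
Lemma lin_net_split w a x l b j : (a < l)%N -> (l < L)%N -> (l <= b <= L)%N ->
  (j < d b)%N -> unique_node_layer d P l ->
  lin_net L d P w a x b j =
  lin_net L d P w a x l (the_node d P l) *
  lin_net L d P w l (fun t => (t == the_node d P l)%:R) b j.
Proof.
move=> lt_al ltlL; elim: b j => [|b IHb] j le_lb lt_j ul; first by lia.
have [lt_bl|le_lb'] := ltnP b l.
  have el : b.+1 = l by lia.
  move: lt_j; rewrite el lin_net_start => lt_j.
  case: eqP => [->|/eqP ne]; rewrite ?mulr1 ?mulr0 //.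
  apply: lin_net_inactive; first by lia.
  have [_ _ uniq_l] := the_nodeP ul.
  by apply: contra ne => /(uniq_l _ lt_j) ->.
rewrite !lin_netS //; last by lia.
case: ifP => _; first by rewrite mulr0.
rewrite mulr_sumr; apply: eq_bigr => i _; rewrite mulrCA IHb //; lia.
Qed.

End Ring.

(** Evaluating, killing or scaling weights in an output thus amounts to running the network on new
    weights and inputs. *)
Lemma rmorph_lin_net (T T' : comNzRingType) (f : {rmorphism T -> T'}) w a x k j :
  f (lin_net L d P w a x k j) =
  lin_net L d P (fun m i t => f (w m i t)) a (fun t => f (x t)) k j.
Proof.
elim: k j => //= k IHk j; case: ifP => // _.
by do 2?case: ifP => _; rewrite ?rmorph0 // rmorph_sum;
  apply: eq_bigr => i _; rewrite rmorphM IHk.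
Qed.

End LinNet.

#[local] Arguments lin_net : simpl never.

(** * Points where a polynomial does not vanish *)

Lemma poly_nonroot (R : numDomainType) (p : {poly R}) :
  p != 0 -> exists x, ~~ root p x.
Proof.
(* These are [size p] distinct points, more than the degree of [p]. *)
move=> p0; pose s := [seq i%:R : R | i <- iota 0 (size p)].
have us : uniq s.
  by rewrite map_inj_uniq ?iota_uniq // => i j /eqP; rewrite eqr_nat => /eqP.
have : ~~ all (root p) s.
  apply/negP => rs; have := max_poly_roots p0 rs us.
  by rewrite size_map size_iota ltnn.
by case/allPn=> x _; exists x.
Qed.

(** The last variable is chosen after the others, whose values keep the leading coefficient
    nonzero. *)
Lemma mpoly_nonroot (R : numDomainType) n (p : mpoly R n) :
  p != 0 -> exists e, mpeval (T := R) idfun e n p != 0.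
Proof.
elim: n p => [|n IHn] p p0; first by exists (fun=> 0).
have lp0 : lead_coef (p : {poly mpoly R n}) != 0 by rewrite lead_coef_eq0.
have [e ep] := IHn _ lp0.
set ev := mpeval _ e n in ep.
have : map_poly ev (p : {poly mpoly R n}) != 0.
  apply: contraNneq ep => /polyP/(_ (size (p : {poly mpoly R n})).-1).
  by rewrite coef0 coef_map -lead_coefE => ->.
case/poly_nonroot=> x px; exists (fun v => if v == n then x else e v).
rewrite /= /horner_morph eqxx; rewrite /root in px.
rewrite (_ : map_poly _ p = map_poly ev (p : {poly mpoly R n})) //.
apply: eq_map_poly; apply: mpoly_rmorph_ext => [c|v lt_vn].
  by rewrite !mpeval_const.
by rewrite !mpeval_var // ltn_eqF.
Qed.

(** * Sets of weight variables *)

Section EdgeSets.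
Variables (L : nat) (d : nat -> nat).

Definition edge_set (E : nat -> nat -> nat -> bool) : pred nat :=
  fun v => let '(k, i, j) := edge L d v in E k i j.

Definition layers_in (a b : nat) := edge_set (fun k _ _ => a <= k < b)%N.

Definition crossing (phi : nat -> nat -> bool) :=
  edge_set (fun k i j => phi k.+1 j && ~~ phi k i).

Lemma edge_set_widx E k i j :
  valid_edge L d k i j -> edge_set E (widx d k i j) = E k i j.
Proof. by move=> ve; rewrite /edge_set widxK. Qed.

Lemma sub_edge_set (E E' : nat -> nat -> nat -> bool) : (forall k i j, E k i j -> E' k i j) ->
  subpred (edge_set E) (edge_set E').
Proof. by move=> sE v; rewrite /edge_set; case: edge => [[k i] j]; apply: sE. Qed.

End EdgeSets.

(** * Irreducibility and divisibility for a single sub-network output *)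

Section Subnet.
Variable R : realFieldType.
Variables (L : nat) (d : nat -> nat) (P : nat -> nat -> bool).
Local Notation n := (nweights L d).
Local Notation M := (mpoly R n).
Local Notation C := (@mpconst R n).
Local Notation W := (wvars R L d).

Lemma rmorph_subnet (T : comNzRingType) (g : {rmorphism M -> T}) w a xa b j :
  (1 <= a <= b)%N -> (b <= L)%N -> (j < d b)%N ->
  (forall k i t, (a <= k < b)%N -> valid_edge L d k i t -> g (W k i t) = w k i t) ->
  g (lin_net L d P W a xa b j) = lin_net L d P w a (fun t => g (xa t)) b j.
Proof. by move=> *; rewrite rmorph_lin_net; apply: eq_lin_net. Qed.

Variables (a b jb : nat) (xa : nat -> R).
Hypotheses (a_ge1 : (1 <= a)%N) (lt_ab : (a < b)%N) (le_bL : (b <= L)%N).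
Hypothesis lt_jb : (jb < d b)%N.

Let f : M := lin_net L d P W a (fun t => C (xa t)) b jb.
Let V := layers_in L d a b.

Lemma subnet_cut phi : (forall i, phi a i = false) ->
  (forall k i t, phi k i -> phi k.+1 t) -> phi b jb ->
  mpscale (crossing L d phi) f = 'X * f%:P.
Proof.
move=> phia phiS phib; rewrite /f (rmorph_subnet
  (w := fun k i t =>
     if phi k.+1 t && ~~ phi k i then 'X * (W k i t)%:P else (W k i t)%:P)); try lia.
  rewrite (lin_net_cut _ _ _ 'X (fun k i t => (W k i t)%:P)) //; last by lia.
  rewrite phib (rmorph_lin_net _ _ _ polyC); congr (_ * _).
  by apply: eq_lin_net => // *; rewrite ?mpscaleC //; lia.
by move=> k i t _ ve; rewrite mpscaleX ?widx_ltn // /crossing edge_set_widx.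
Qed.

Lemma free_of_subnet (E : nat -> nat -> nat -> bool) :
  (forall k i t, (a <= k < b)%N -> E k i t = false) ->
  free_of (edge_set L d E) f.
Proof.
move=> E0; rewrite /free_of {1}/f (rmorph_subnet (w := W)) //; try lia.
  by apply/eqP; apply: eq_lin_net => // *; rewrite ?mpkillC //; lia.
by move=> k i t Hk ve; rewrite mpkillX ?widx_ltn // edge_set_widx // E0.
Qed.

(** The weights of [V] are specialised at a point where [f] takes a nonzero value [c]. This fixes
    [q] and [r], so [c * r = q * sp h]; multiplying by [f / c] and cancelling [q] gives [h]. *)
Lemma prime_of_free (q h r : M) : f != 0 -> q != 0 -> f * r = q * h ->
  free_of V r -> free_of V q -> exists2 r', free_of V r' & h = f * r'.
Proof.
move=> f0 q0 E /eqP fr /eqP fq.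
have [e ef] := mpoly_nonroot f0; set c := mpeval _ _ _ _ in ef.
pose sp : {rmorphism M -> M} :=
  mpeval C (fun v => if V v then C (e v) else mpvar R n v) n.
have spC x : sp (C x) = C x by rewrite mpeval_const.
have spX v : (v < n)%N -> sp (mpvar R n v) = if V v then C (e v) else mpvar R n v.
  exact: mpeval_var.
have sp_kill p : sp (mpkill V p) = mpkill V p.
  apply: (mpoly_rmorph_ext (f := sp \o mpkill V)) => [x|v lt_v] /=.
    by rewrite !mpkillC.
  by rewrite !mpkillX //; case: ifP => Vv; rewrite ?rmorph0 ?spX ?Vv.
have kill_sp p : mpkill V (sp p) = sp p.
  apply: (mpoly_rmorph_ext (f := mpkill V \o sp)) => [x|v lt_v] /=.
    by rewrite !spC mpkillC.
  by rewrite !spX //; case: ifP => Vv; rewrite ?mpkillC ?mpkillX ?Vv.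
have spf : sp f = C c.
  rewrite /c /f (rmorph_subnet (w := fun k i t => C (e (widx d k i t)))) //; try lia.
    rewrite (rmorph_subnet (w := fun k i t => e (widx d k i t))) //; try lia.
      rewrite rmorph_lin_net; apply: eq_lin_net => //; first by lia.
      by move=> i _; rewrite spC mpeval_const.
    by move=> k i t _ ve; rewrite mpeval_var ?widx_ltn.
  move=> k i t Hk ve; rewrite spX ?widx_ltn //.
  by rewrite /V /layers_in edge_set_widx // Hk.
exists (C c^-1 * sp h); first by rewrite free_ofM ?free_ofC // /free_of kill_sp.
have Esp := congr1 sp E; rewrite !rmorphM spf in Esp.
rewrite -{1}fr -{1}fq !sp_kill fr fq in Esp.
apply: (mulfI q0); rewrite -E mulrCA (mulrCA q) -Esp.
by congr (_ * _); rewrite mulrA -rmorphM mulVf // rmorph1 mul1r.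
Qed.

Hypothesis Pb : (b < L)%N -> P b jb.
Variable w0 : nat -> nat -> nat -> R.
Hypothesis pos : forall k j, (a < k < b)%N -> (j < d k)%N -> P k j ->
  0 < lin_net L d P w0 a xa k j.
Hypothesis two : forall k (j : nat), (a < k < b)%N ->
  exists j', [/\ (j' < d k)%N, P k j' & j' != j].

(** The weights follow [w0] up to layer [k.+1], where [pos] makes the value of [j] positive; then
    only the edges out of [j] are kept, and all later weights are 1. Positivity spreads because
    every inner layer has an active node. *)
Lemma subnet_through k j : (a <= k)%N -> (k.+1 < b)%N -> (j < d k.+1)%N -> P k.+1 j ->
  0 < lin_net L d P (fun m i t => if (m <= k)%N then w0 m i t
                                  else if m == k.+1 then (i == j)%:R else 1) a xa b jb.
Proof.
move=> le_ak lt_kb lt_j Pj; set e := fun m i t => _.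
suff H m t : (k.+1 < m <= b)%N -> (t < d m)%N -> ((m < L)%N -> P m t) ->
    0 < lin_net L d P e a xa m t by apply: H; rewrite // lt_kb leqnn.
elim: m t => [|m IHm] t Hm lt_t Pt; first by lia.
rewrite lin_netS; last by lia.
rewrite ifF; last by case: ltnP Pt => // _ ->.
have [lt_km|le_mk] := ltnP k.+1 m; last first.
  have {m le_mk IHm Hm lt_t Pt} -> : m = k.+1 by lia.
  rewrite (bigD1 (Ordinal lt_j)) //= big1 ?addr0.
    rewrite /e ltnn !eqxx mul1r (_ : lin_net _ _ _ _ _ _ _ _ = lin_net L d P w0 a xa k.+1 j).
      by apply: pos => //; lia.
    apply: eq_lin_net => // [||k' i' t' Hk' _]; [by lia|by lia|].
    by rewrite ifT //; lia.
  move=> i; rewrite -val_eqE /= => /negPf ij.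
  by rewrite /e ltnn eqxx ij mul0r.
have [j' [lt_j' Pj' _]] := two 0%N (k := m) ltac:(lia).
have em i t' : e m i t' = 1 by rewrite /e !ifF //; lia.
have ge0 (i : 'I_(d m)) : 0 <= lin_net L d P e a xa m i.
  have [Pi|Pi] := boolP (P m i); first by rewrite ltW // IHm //; lia.
  by rewrite lin_net_inactive //; lia.
rewrite (bigD1 (Ordinal lt_j')) //= ltr_wpDr ?em ?mul1r //.
  by apply: sumr_ge0 => i _; rewrite em mul1r.
by apply: IHm => //; lia.
Qed.

(** At the point of [subnet_through] all flow passes through [j] and [f] is positive; erasing all
    edges into [j], or all edges out of it, makes the value 0. *)
Lemma not_free_of_subnet k j (E : nat -> nat -> nat -> bool) :
  (a <= k)%N -> (k.+1 < b)%N -> (j < d k.+1)%N ->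
  P k.+1 j -> (forall i, E k i j) \/ (forall t, E k.+1 j t) ->
  ~~ free_of (edge_set L d E) f.
Proof.
move=> le_ak lt_kb lt_j Pj HE; apply/negP => /eqP fE.
have := subnet_through le_ak lt_kb lt_j Pj; set e := fun m i t => _.
pose env v := let '(m, i, t) := edge L d v in e m i t.
have envE m i t : valid_edge L d m i t -> env (widx d m i t) = e m i t.
  by move=> ve; rewrite /env widxK.
pose ev := mpeval (T := R) idfun env n.
have evf : ev f = lin_net L d P e a xa b jb.
  rewrite /f (rmorph_subnet (w := e)); try lia.
    by apply: eq_lin_net => // *; rewrite ?mpeval_const //; lia.
  by move=> m i t _ ve; rewrite mpeval_var ?widx_ltn // envE.
have : (ev \o mpkill (edge_set L d E)) f = 0.
  rewrite (rmorph_subnet (w := fun m i t => if E m i t then 0 else e m i t)); try lia.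
    (* All of layer [k.+2] vanishes: nodes other than [j] have outgoing weight 0, and [j] is cut off
       on one side. *)
    apply: (@lin_net_zero _ _ _ _ _ _ _ k.+2) => //; first by lia.
    move=> t lt_t; rewrite lin_netS; last by lia.
    case: ifP => // _; apply: big1 => i _.
    have [->|ij] := eqVneq (i : nat) j; last first.
      by rewrite /e ltnn eqxx (negPf ij) if_same mul0r.
    case: HE => HE; last by rewrite HE mul0r.
    rewrite (_ : lin_net _ _ _ _ _ _ _ _ = 0) ?mulr0 // lin_netS //.
    by case: ifP => // _; apply: big1 => i' _; rewrite HE mul0r.
  move=> m i t _ ve /=; rewrite mpkillX ?widx_ltn // edge_set_widx //.
  by case: ifP => _; rewrite ?rmorph0 // mpeval_var ?widx_ltn // envE.
by rewrite /= fE evf => ->; rewrite ltxx.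
Qed.

Lemma subnet_core (q h r : M) : f * r != 0 -> f * r = q * h -> free_of V r ->
  free_of V q || free_of V h.
Proof.
move=> fr0 E fr.
(* The cut lies within [V], so [r] is free of it and [f * r] is linear in it, just as [f] is. *)
have key phi q' h' : f * r = q' * h' -> (forall i, phi a i = false) ->
    (forall k i t, phi k i -> phi k.+1 t) -> phi b jb ->
    (forall k i t, phi k.+1 t && ~~ phi k i -> (a <= k < b)%N) ->
    free_of (crossing L d phi) q' || free_of (crossing L d phi) h'.
  move=> E' phia phiS phib phiV; apply: free_of_linear; rewrite -?E' //.
  rewrite rmorphM subnet_cut // mpscale_free ?polyCM ?mulrA //.
  by apply: free_ofS fr; apply: sub_edge_set.
have layer k q' h' : f * r = q' * h' -> (a <= k < b)%N ->
    free_of (layers_in L d k k.+1) q' || free_of (layers_in L d k k.+1) h'.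
  (* This cut is the whole layer [k] of weights. *)
  move=> E' Hk; pose phi (m _ : nat) := (k < m)%N.
  have sub : subpred (layers_in L d k k.+1) (crossing L d phi).
    by apply: sub_edge_set => m i t; rewrite /phi; lia.
  have /orP[] : free_of (crossing L d phi) q' || free_of (crossing L d phi) h'.
    by apply: key => // *; unfold phi in *; lia.
    by move/(free_ofS sub) ->.
  by move/(free_ofS sub) ->; rewrite orbT.
(* By symmetry, [q'] is the factor that misses the first layer of weights; by induction it misses
   every later one. *)
suff main q' h' : f * r = q' * h' -> free_of (layers_in L d a a.+1) q' -> free_of V q'.
  case/orP: (layer a q h E ltac:(lia)) => H; first by rewrite (main q h).
  by rewrite (main h q) ?orbT // E mulrC.
move=> E' fa; rewrite /V.
suff H k : (a < k <= b)%N -> free_of (layers_in L d a k) q' by apply: H; lia.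
elim: k => [|k IHk] Hk; first by lia.
have [<-//|ne_ak] := eqVneq a k.
have fk : free_of (layers_in L d a k) q' by apply: IHk; lia.
have sub : subpred (layers_in L d a k.+1)
    (predU (layers_in L d a k) (layers_in L d k k.+1)).
  by move=> v; rewrite /layers_in /edge_set /=; case: edge => [[m i] j]; lia.
case/orP: (layer k q' h' E' ltac:(lia)) => [fk'|hk].
  exact: free_ofS sub (free_ofU fk fk').
(* Now [q'] misses the weights before an inner node layer and [h'] those after it. Two active nodes
   of this layer, renumbered [k.+1], refute this. *)
exfalso; case: k Hk ne_ak fk hk {IHk sub} => [|k] Hk ne_ak fk hk; first by lia.
have [j [lt_j Pj _]] := two 0%N (k := k.+1) ltac:(lia).
have [j' [lt_j' Pj' ne_j]] := two j (k := k.+1) ltac:(lia).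
(* If both factors missed all edges into [i], or all edges out of [i], then so would [f]. *)
have nfree (E0 : nat -> nat -> nat -> bool) i : (i < d k.+1)%N -> P k.+1 i ->
    (forall t, E0 k t i) \/ (forall t, E0 k.+1 i t) ->
    (forall m i t, E0 m i t -> (a <= m < b)%N) ->
    free_of (edge_set L d E0) q' -> free_of (edge_set L d E0) h' -> False.
  move=> lt_i Pi HE EV fq fh; have := free_ofM fq fh; rewrite -E'.
  move/free_of_mull => /(_ fr0); apply/negP.
  by apply: not_free_of_subnet lt_i Pi HE; lia.
(* The far side is [j] with all layers after [k.+1]; it is entered by the edges into [j] and those
   out of the other nodes of its layer. *)
pose phi m t := (k.+1 < m)%N || ((m == k.+1) && (t == j)).
have /orP[] : free_of (crossing L d phi) q' || free_of (crossing L d phi) h'.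
  by apply: key => // *; unfold phi in *; lia.
  (* If [q'] misses the cut, both factors miss the edges out of [j']. *)
  move=> H; apply: (nfree (fun m i _ => (m == k.+1) && (i == j'))%N j') => //.
  - by right=> t; rewrite !eqxx.
  - by move=> *; lia.
  - by apply: free_ofS H; apply: sub_edge_set => m i t; rewrite /phi; lia.
  - by apply: free_ofS hk; apply: sub_edge_set => m i t; rewrite /phi; lia.
(* If [h'] misses it, both miss the edges into [j]. *)
move=> H; apply: (nfree (fun m _ t => (m == k) && (t == j))%N j) => //.
- by left=> t; rewrite !eqxx.
- by move=> *; lia.
- by apply: free_ofS fk; apply: sub_edge_set => m i t; rewrite /phi; lia.
- by apply: free_ofS H; apply: sub_edge_set => m i t; rewrite /phi; lia.
Qed.

Lemma subnet_prime (q h r : M) : f * r != 0 -> f * r = q * h -> free_of V r ->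
  (exists2 r', free_of V r' & q = f * r') \/ (exists2 r', free_of V r' & h = f * r').
Proof.
move=> fr0 E fr; move: (fr0); rewrite mulf_eq0 negb_or => /andP[f0 _].
move: (fr0); rewrite E mulf_eq0 negb_or => /andP[q0 h0].
case/orP: (subnet_core fr0 E fr) => H; [right|left].
  exact: prime_of_free E fr H.
by apply: (prime_of_free (q := h) (r := r)) => //; rewrite E mulrC.
Qed.

Lemma subnet_irreducible : f != 0 -> mp_irreducible f.
Proof.
move=> f0; split.
  move/mp_is_constP => fc; move/eqP: f0; apply.
  (* A constant would miss the first layer of weights, in which [f] is linear. *)
  apply: (free_of_linear_eq0 (S := crossing L d (fun m _ => a < m)%N)).
    by apply: subnet_cut => *; lia.
  exact: free_ofS fc.
(* A divisor of [f] has no weight outside [V]; with none inside either, it is constant. *)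
have compl p q : f = p * q -> free_of V p -> mp_is_const p.
  move=> E fp; apply/mp_is_constP.
  have fp' : free_of (edge_set L d (fun k _ _ => ~~ (a <= k < b)%N)) p.
    by apply: (free_of_mull (q := q)); rewrite -E // free_of_subnet // => k _ _ ->.
  apply: free_ofS (free_ofU fp fp') => v _ /=.
  by rewrite /V /layers_in /edge_set; case: edge => [[k i] j]; apply: orbN.
move=> q h E; have f10 : f * 1 != 0 by rewrite mulr1.
have E1 : f * 1 = q * h by rewrite mulr1.
have f1 : free_of V (1 : M) by apply/eqP; apply: rmorph1.
case/orP: (subnet_core f10 E1 f1) => H; [left|right].
  exact: compl E H.
by apply: (compl h q) => //; rewrite mulrC.
Qed.

End Subnet.

(** * Counting the factors of an irreducible factorization *)

Section Counting.
Variables (R : fieldType) (n : nat).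
Local Notation M := (mpoly R n).

(* Weak form of primality that avoids proving that [mpoly R n] is factorial:
   the cofactors met when cancelling the factors of [u] in turn are free of
   [V]. *)
Definition prime_wrt (V : pred nat) (f : M) := forall q h r : M,
  f * r != 0 -> f * r = q * h -> free_of V r ->
  (exists2 r', free_of V r' & q = f * r') \/ (exists2 r', free_of V r' & h = f * r').

(** Either [f] divides the first factor, or the product of the rest is again [f] times a cofactor
    free of [V], and the induction continues with that cofactor. *)
Lemma prime_wrt_dvd_prod V f r (gs : seq M) : prime_wrt V f -> ~ mp_is_const f ->
  f * r != 0 -> f * r = \prod_(g <- gs) g -> free_of V r ->
  exists gs1 gs2 r', gs = gs1 ++ (f * r') :: gs2.
Proof.
move=> fP fNc; elim: gs r => [|g gs IHgs] r fr0 E fr.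
  case: fNc; apply/mp_is_constP; apply: (free_of_mull fr0).
  by rewrite E big_nil; apply/eqP; apply: rmorph1.
rewrite big_cons in E; case: (fP _ _ _ fr0 E fr) => [[r' _ ->]|[r' fr' E']].
  by exists [::], gs, r'.
have fr'0 : f * r' != 0.
  by move: fr0; rewrite E E' mulf_eq0 negb_or => /andP[].
have [gs1 [gs2 [r'' ->]]] := IHgs r' fr'0 (esym E') fr'.
by exists (g :: gs1), gs2, r''.
Qed.

Variables (N : nat) (F : nat -> M) (V : nat -> pred nat).
Hypothesis F_prime : forall s, (s < N)%N -> prime_wrt (V s) (F s).
Hypothesis F_nconst : forall s, (s < N)%N -> ~ mp_is_const (F s).
Hypothesis F_free : forall s t, (s < t < N)%N -> free_of (V s) (F t).

(** Induction on the number of [F t] left: [F s] divides a member of [gs], which by irreducibility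
    is a constant times [F s]; both are cancelled and [c] absorbs the constant. *)
Lemma size_irreducible_factors s c (gs : seq M) : (s <= N)%N -> c != 0 ->
  (forall g, g \in gs -> mp_irreducible g) ->
  \prod_(s <= t < N) F t = mpconst n c * \prod_(g <- gs) g -> size gs = (N - s)%N.
Proof.
move=> + + + E; have [m Em] : exists m, m = (N - s)%N by exists (N - s)%N.
elim: m s c gs Em E => [|m IHm] s c gs Em E le_sN c0 gs_irr; rewrite -Em.
  (* With no [F t] left, an irreducible [g] would divide 1. *)
  case: gs E gs_irr => // g gs E /(_ _ (mem_head _ _)) [gNc _]; case: gNc.
  move: E; rewrite big_geq; last by lia.
  rewrite big_cons mulrCA => E; apply/mp_is_constP.
  have := @free_of_mull _ _ predT g (mpconst n c * \prod_(g <- gs) g); rewrite -E.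
  by apply; [apply: oner_neq0 | apply/eqP; apply: rmorph1].
have lt_sN : (s < N)%N by lia.
have F0 t : (t < N)%N -> F t != 0.
  move=> /F_nconst Fc; apply/eqP => F0; apply: Fc; exists 0.
  by rewrite F0 rmorph0.
rewrite big_ltn // in E.
have Cc : mpconst n c^-1 * mpconst n c = 1 by rewrite -rmorphM mulVf // rmorph1.
pose r := mpconst n c^-1 * \prod_(s.+1 <= t < N) F t.
have Er : F s * r = \prod_(g <- gs) g by rewrite /r mulrCA E mulrA Cc mul1r.
have rest0 : \prod_(s.+1 <= t < N) F t != 0.
  rewrite big_nat; apply: (big_ind (fun x => x != 0)) => [|x y|t] //.
  - exact: oner_neq0.
  - by move=> x0 y0; rewrite mulf_neq0.
  - by move=> /andP[_ /F0].
have fr : free_of (V s) r.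
  rewrite free_ofM ?free_ofC // big_nat; apply: free_of_prod => t Ht.
  by apply: F_free; lia.
have r0 : r != 0 by rewrite mulf_neq0 // mpconst_eq0 invr_eq0.
have Fr0 : F s * r != 0 by rewrite mulf_neq0 ?F0.
have [gs1 [gs2 [r' Egs]]] :=
  prime_wrt_dvd_prod (F_prime lt_sN) (@F_nconst _ lt_sN) Fr0 Er fr.
have [_ /(_ _ _ erefl) []] : mp_irreducible (F s * r').
- by apply: gs_irr; rewrite Egs mem_cat mem_head orbT.
- by move/(F_nconst lt_sN).
case=> c' Er'.
have Eg : \prod_(g <- gs) g = F s * (mpconst n c' * \prod_(g <- gs1 ++ gs2) g).
  by rewrite Egs !big_cat big_cons /= Er' mulrCA -!mulrA.
rewrite Eg mulrCA in E; have {}E := mulfI (F0 _ lt_sN) E.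
rewrite mulrA -rmorphM in E.
have cc'0 : c * c' != 0.
  apply: contra_neq rest0 => cc'0; rewrite E cc'0 rmorph0; exact: mul0r.
have := IHm s.+1 _ _ _ E lt_sN cc'0; rewrite Egs !size_cat /= addnS => ->; try lia.
by move=> g; rewrite mem_cat => Hg; apply: gs_irr; rewrite Egs mem_cat inE orbCA Hg orbT.
Qed.

End Counting.

(** * The layers that bound the sub-networks *)

Section Bounds.
Variables (L : nat) (d : nat -> nat) (P : nat -> nat -> bool).
Hypothesis L_gt1 : (1 < L)%N.
Local Notation bs := (bounds L d P).
Local Notation N := (size (unique_layers L d P)).+1.

Lemma mem_unique_layers l :
  (l \in unique_layers L d P) = (1 < l < L)%N && unique_node_layer d P l.
Proof. by rewrite mem_filter mem_iota andbC; congr (_ && _); lia. Qed.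

Lemma bounds_sorted : sorted ltn bs.
Proof.
rewrite /bounds /= rcons_path; apply/andP; split.
  rewrite (path_sortedE ltn_trans); apply/andP; split.
    by apply/allP => l; rewrite mem_unique_layers; lia.
  by apply: (sorted_filter ltn_trans); apply: iota_ltn_sorted.
have := mem_last 1%N (unique_layers L d P); rewrite inE mem_unique_layers.
by move: (last _ _); lia.
Qed.

Lemma bounds_mid s : (s < N.-1)%N ->
  (1 < nth 0 bs s.+1 < L)%N && unique_node_layer d P (nth 0%N bs s.+1).
Proof. by move=> lt_s; rewrite -mem_unique_layers /= nth_rcons lt_s mem_nth. Qed.

Lemma bounds_last : nth 0%N bs N = L.
Proof. by rewrite /= nth_rcons ltnn eqxx. Qed.

Lemma bounds_lt s : (s < N)%N -> (nth 0 bs s < nth 0 bs s.+1)%N.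
Proof.
move=> lt_s; apply: (sorted_ltn_nth ltn_trans 0%N bounds_sorted);
  by rewrite // inE /= size_rcons; lia.
Qed.

Lemma bounds_le s t : (s <= t <= N)%N -> (nth 0 bs s <= nth 0 bs t)%N.
Proof.
case/andP=> le_st le_t.
have le_bs : sorted leq bs by apply: sub_sorted bounds_sorted => x y /ltnW.
by apply: (sorted_leq_nth leq_trans leqnn 0%N le_bs) => //;
  rewrite inE /= size_rcons; lia.
Qed.

Lemma bounds_range s : (s < N)%N ->
  [/\ (1 <= nth 0 bs s)%N, (nth 0 bs s < nth 0 bs s.+1)%N & (nth 0 bs s.+1 <= L)%N].
Proof.
move=> lt_s; split; [|exact: bounds_lt|].
  exact: (@bounds_le 0 s ltac:(lia)).
by rewrite -{2}bounds_last bounds_le //; lia.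
Qed.

(** Otherwise [k] would occur in the sorted list [bs] between two consecutive entries. *)
Lemma bounds_gap s k : (s < N)%N -> (nth 0 bs s < k < nth 0 bs s.+1)%N ->
  ~~ unique_node_layer d P k.
Proof.
move=> lt_s Hk; apply/negP => uk.
have [ge1 _ leL] := bounds_range lt_s.
have kbs : k \in bs.
  by rewrite /bounds inE mem_rcons inE mem_unique_layers uk; lia.
have := nth_index 0%N kbs; have := kbs; rewrite -index_mem [size _]/= size_rcons => lt_i Ek.
have [le|gt] := leqP (index k bs) s.
  by have := @bounds_le (index k bs) s ltac:(lia); rewrite Ek; lia.
by have := @bounds_le s.+1 (index k bs) ltac:(lia); rewrite Ek; lia.
Qed.

End Bounds.

(** [relu] keeps the positive pre-output of an active node and sends that of an inactive one to
    0. *)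
Lemma lin_net_relu_out (R : realDomainType) L d w (x : nat -> R) k j : (k < L)%N ->
  lin_net L d (activation_set d w x) w 1 x k j = relu_out d w x k j.
Proof.
elim: k j => // [[|k]] IHk j lt_kL; first by rewrite lin_net_start.
rewrite lin_netS // lt_kL /=.
rewrite (eq_bigr (fun i : 'I__ => w k.+1 i j * relu_out d w x k.+1 i)); last first.
  by move=> i _; rewrite IHk // ltnW.
rewrite /activation_set /= /relu; set z := \sum_(i < _) _.
by rewrite lt_max ltxx /= -leNgt; case: leP.
Qed.

(** * The sub-network factors of the virtual polynomial *)

Section Factorization.
Variables (R : rcfType) (L : nat) (d : nat -> nat).
Variables (x0 : nat -> R) (w0 : nat -> nat -> nat -> R) (i : nat).
Hypotheses (L_gt1 : (1 < L)%N) (lt_i : (i < d L)%N).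
Local Notation n := (nweights L d).
Local Notation M := (mpoly R n).
Local Notation C := (@mpconst R n).
Local Notation W := (wvars R L d).
Let P := activation_set d w0 x0.
Let u := virtual_poly L d P x0 L i.
Hypothesis u_neq0 : u != 0.
Local Notation bs := (bounds L d P).
Local Notation N := (size (unique_layers L d P)).+1.
Local Notation F := (subnet_factor L d P x0 i).

Let start s := nth 0%N bs s.
Let out s := if s.+1 == N then i else the_node d P (start s.+1).
Let input s : nat -> R :=
  if s == 0%N then x0 else fun t => (t == the_node d P (start s))%:R.

Lemma start_unique s : (0 < s < N)%N ->
  (1 < start s < L)%N && unique_node_layer d P (start s).
Proof. by case: s => // s lt_s; apply: bounds_mid. Qed.

Lemma start_range s : (s < N)%N ->
  [/\ (1 <= start s)%N, (start s < start s.+1)%N & (start s.+1 <= L)%N].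
Proof. exact: bounds_range. Qed.

Lemma outP s : (s < N)%N ->
  (out s < d (start s.+1))%N /\ ((start s.+1 < L)%N -> P (start s.+1) (out s)).
Proof.
move=> lt_s; rewrite /out; case: eqP => [Es|ne].
  by rewrite Es /start bounds_last // ltnn.
have /andP[_ /the_nodeP[lt_n Pn _]] := @start_unique s.+1 ltac:(lia).
by [].
Qed.

Lemma subnet_factorE s : (s < N)%N ->
  F s = lin_net L d P W (start s) (fun t => C (input s t)) (start s.+1) (out s).
Proof.
move=> lt_s; rewrite /subnet_factor -/(start s) -/(start s.+1) -/(out s).
have [ge1 lt_ss leL] := start_range lt_s; have [lt_o _] := outP lt_s.
apply: eq_lin_net => // [|t _]; first by lia.
by rewrite /input; case: (s == 0%N); rewrite ?rmorph_nat.
Qed.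

(** Each new factor is split off at the unique node of the layer where it starts. *)
Lemma prefix_prod s : (s < N)%N ->
  lin_net L d P W 1 (fun t => C (x0 t)) (start s.+1) (out s) =
  \prod_(t < s.+1) F t.
Proof.
elim: s => [|s IHs] lt_s; first by rewrite big_ord1 subnet_factorE.
have [ge1 lt_ss leL] := start_range lt_s; have [lt_o _] := outP lt_s.
have /andP[Hs us] := @start_unique s.+1 ltac:(lia).
have Hspl : (start s.+1 <= start s.+2 <= L)%N by lia.
rewrite (lin_net_split W _ _ _ Hspl lt_o us); try lia.
rewrite big_ord_recr.
rewrite -IHs; last by lia.
congr (_ * _); first by rewrite /out ifF //; lia.
Qed.

Lemma virtual_poly_prod : u = \prod_(s < N) F s.
Proof.
by rewrite -prefix_prod // /start bounds_last // /out eqxx.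
Qed.

Lemma subnet_factor_neq0 s : (s < N)%N -> F s != 0.
Proof.
move=> lt_s; move: u_neq0; rewrite virtual_poly_prod (bigD1 (Ordinal lt_s)) //=.
by rewrite mulf_eq0 negb_or => /andP[].
Qed.

(** The whole network is positive at an active node; for [s > 0] its value there is the positive one
    at the unique node of layer [start s] times that of the sub-network. *)
Lemma input_pos s k j : (s < N)%N -> (start s < k < start s.+1)%N -> (j < d k)%N ->
  P k j -> 0 < lin_net L d P w0 (start s) (input s) k j.
Proof.
move=> lt_s Hk lt_j Pj; have [ge1 _ leL] := start_range lt_s.
have netP : 0 < lin_net L d P w0 1 x0 k j.
  by rewrite lin_net_relu_out //; lia.
case: s lt_s Hk ge1 leL => [//|s] lt_s Hk _ leL.
have /andP[Hs us] := @start_unique s.+1 ltac:(lia).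
have [lt_n Pn _] := the_nodeP us.
move: netP; rewrite (lin_net_split _ _ (l := start s.+1)) //; try lia.
rewrite pmulr_rgt0 // lin_net_relu_out //; lia.
Qed.

Lemma active_two s k (j : nat) : (s < N)%N -> (start s < k < start s.+1)%N ->
  exists j', [/\ (j' < d k)%N, P k j' & j' != j].
Proof.
move=> lt_s Hk; have [ge1 _ leL] := start_range lt_s.
have := bounds_gap L_gt1 lt_s Hk; rewrite /unique_node_layer.
set A := [set _ | _] => A1.
(* A layer without active nodes would make [u] zero. *)
have : (0 < #|A|)%N.
  rewrite card_gt0; apply: contra_neq u_neq0 => /setP A0.
  apply: (@lin_net_zero _ _ _ _ _ _ _ k) => //; first by lia.
  move=> t lt_t; apply: lin_net_inactive; first by lia.
  by have := A0 (Ordinal lt_t); rewrite !inE => ->.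
move=> A_gt0; have /card_gt1P[x [y [Ax Ay xy]]] : (1 < #|A|)%N by lia.
rewrite !inE in Ax Ay.
have [Ex|ne] := eqVneq (x : nat) j; last by exists x.
by exists y; split=> //; rewrite -Ex eq_sym.
Qed.

Lemma subnet_factor_irreducible s : (s < N)%N -> mp_irreducible (F s).
Proof.
move=> lt_s; have [ge1 lt_ss leL] := start_range lt_s; have [lt_o Po] := outP lt_s.
have := subnet_factor_neq0 lt_s; rewrite subnet_factorE //.
have two k j := @active_two s k j lt_s; have pos k j := @input_pos s k j lt_s.
exact: (subnet_irreducible ge1 lt_ss leL lt_o Po pos two).
Qed.

Lemma subnet_factor_prime s : (s < N)%N ->
  prime_wrt (layers_in L d (start s) (start s.+1)) (F s).
Proof.
move=> lt_s; have [ge1 lt_ss leL] := start_range lt_s; have [lt_o Po] := outP lt_s.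
rewrite subnet_factorE // => q h r.
have two k j := @active_two s k j lt_s; have pos k j := @input_pos s k j lt_s.
exact: (subnet_prime ge1 lt_ss leL lt_o Po pos two).
Qed.

Lemma subnet_factor_free s t : (s < t < N)%N ->
  free_of (layers_in L d (start s) (start s.+1)) (F t).
Proof.
case/andP=> lt_st lt_t.
have [ge1 lt_tt leL] := start_range lt_t; have [lt_o _] := outP lt_t.
rewrite subnet_factorE //; apply: free_of_subnet => // k _ _ Hk.
have : (start s.+1 <= start t)%N by apply: bounds_le => //; lia.
lia.
Qed.

End Factorization.

Theorem theorem2p8 (R : rcfType) (L : nat) (d : nat -> nat)
    (x0 : nat -> R) (w0 : nat -> nat -> nat -> R) (i : nat) :
  (1 < L)%N -> (i < d L)%N ->
  let P := activation_set d w0 x0 in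
  let u := virtual_poly L d P x0 L i in
  u != 0 ->
  (forall n : nat,
     (exists g : 'I_n -> mpoly R (nweights L d),
        (forall s, mp_irreducible (g s)) /\ u = \prod_(s < n) g s)
     <-> (size (unique_layers L d P)).+1 = n)
  /\
  (exists c : nat -> R,
     (forall s, (s < (size (unique_layers L d P)).+1)%N ->
        c s != 0 /\ mp_irreducible (subnet_factor L d P x0 i s))
     /\ u = \prod_(s < (size (unique_layers L d P)).+1)
              (mpconst (nweights L d) (c s) * subnet_factor L d P x0 i s)).
Proof.
move=> L_gt1 lt_i P u u0.
have uE : u = \prod_(s < (size (unique_layers L d P)).+1) subnet_factor L d P x0 i s.
  exact: virtual_poly_prod.
have irr := subnet_factor_irreducible L_gt1 lt_i u0.
split=> [n|]; last first.
  (* The factors multiply to [u] exactly, so all constants are 1. *)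
  exists (fun=> 1); split=> [s lt_s|]; first by rewrite oner_neq0; split=> //; apply: irr.
  by rewrite uE; apply: eq_bigr => s _; rewrite rmorph1 mul1r.
split=> [[g [g_irr Eu]]|<-]; last first.
  by exists (fun s => subnet_factor L d P x0 i s); split=> // s; apply: irr.
pose gs := [seq g s | s <- enum 'I_n].
have : size gs = ((size (unique_layers L d P)).+1 - 0)%N.
  have prim := subnet_factor_prime L_gt1 lt_i u0.
  apply: (size_irreducible_factors prim _ _ (c := 1)) => //.
  - by move=> s /irr[].
  - exact: subnet_factor_free.
  - exact: oner_neq0.
  - by move=> _ /mapP[s _ ->].
  - by rewrite big_mkord -uE Eu rmorph1 mul1r big_map big_enum.
by rewrite size_map size_enum_ord subn0.
Qed.
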